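(* Let $I\subset\mathbb{R}$ be an interval, $a,b\in I$ with $a<b$, and let $f:I\to\mathbb{R}$ be absolutely continuous on the interior $I^{\circ}$ of $I$ with $f''\in L[a,b]$. If $|f''|$ belongs to the class $Q(I)$, then \[ \left|\frac{1}{b-a}\int_a^b f(x)\,dx-\frac{1}{6}\left[f(a)+4f\left(\frac{a+b}{2}\right)+f(b)\right]\right| \le \frac{(b-a)^2}{6}\left(\frac{12\ln 2-8\ln 3+1}{2}\right)\left[|f''(a)|+|f''(b)|\right]. \]
   Context: A function $g:I\to\mathbb{R}$ belongs to the class $Q(I)$ (is a Godunova–Levin function) if $g$ is non-negative and for all $x,y\in I$ and $t\in(0,1)$, \[ g(tx+(1-t)y)\le \frac{g(x)}{t}+\frac{g(y)}{1-t}. \]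
   Formalization: Formalized with f differentiable on I° and both f and f' absolutely continuous on [a,b] (f'' existing almost everywhere); with only f absolutely continuous on I° the claim fails, e.g. for the integral of the Cantor function or a jump of f at an endpoint of I. *)

(* Defs.v *)
From HB Require Import structures.
From mathcomp Require Import all_boot all_order all_algebra.
From mathcomp Require Import all_classical all_reals all_analysis.
Set Implicit Arguments. Unset Strict Implicit. Unset Printing Implicit Defensive.
Import Order.TTheory GRing.Theory Num.Theory.
Import numFieldNormedType.Exports.
Local Open Scope classical_set_scope.
Local Open Scope ring_scope.

Definition GL_class {R : realType} (I : set R) (g : R -> R) : Prop :=
  (forall x, I x -> 0 <= g x) /\
  (forall x y t, I x -> I y -> 0 < t < 1 ->
     g (t * x + (1 - t) * y) <= g x / t + g y / (1 - t)).

Definition abs_cont_on {R : realType} (a b : R) (g : R -> R) : Prop :=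
  forall e : R, 0 < e -> exists2 d : R, 0 < d &
    forall (n : nat) (s : 'I_n -> R * R),
      (forall i, a <= (s i).1 /\ (s i).1 <= (s i).2 /\ (s i).2 <= b) ->
      (forall i j, i != j -> (s i).2 <= (s j).1 \/ (s j).2 <= (s i).1) ->
      \sum_(i < n) ((s i).2 - (s i).1) < d ->
      \sum_(i < n) `|g (s i).2 - g (s i).1| < e.

(* Main.v *)
Require Import Defs.
From HB Require Import structures.
From mathcomp Require Import all_boot all_order all_algebra.
From mathcomp Require Import all_classical all_reals all_analysis.
From mathcomp Require Import ring lra.
Set Implicit Arguments. Unset Strict Implicit. Unset Printing Implicit Defensive.
Import Order.TTheory GRing.Theory Num.Theory.
Import numFieldNormedType.Exports.
Local Open Scope classical_set_scope.
Local Open Scope ring_scope.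

(* Integrating by parts twice against a piecewise quadratic kernel k with k'' = 1 that
   vanishes at a and b turns the Simpson error into the integral of k f''; the class Q
   bounds |f''| by an explicit function h. The integral of f'' never appears: on each of
   the four intervals where k has constant sign, Phi = k f' - k' f + F, with F a
   primitive of f, is absolutely continuous and Phi' = k f'' a.e., so if K is an explicit
   primitive of |k| h, then K + Phi and K - Phi are nondecreasing. This last step needs
   only that an absolutely continuous function with a.e. nonnegative derivative is
   nondecreasing. *)

(** * Monotonicity from an almost everywhere nonnegative derivative *)

(** Let c be the supremum of the points where [P] holds. A point [u] of this set close below c lets
    one step across c without knowing [P] at c: either directly to [b], or to c + r / 2, which
    contradicts the choice of c. *)
Lemma real_induction (R : realType) (P : R -> Prop) (a b : R) :
  a <= b -> P a ->
  (forall x, a <= x <= b -> exists2 r, 0 < r &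
    forall u v, a <= u -> u <= x -> x <= v -> v <= b ->
      x - r < u -> v < x + r -> P u -> P v) ->
  P b.
Proof.
move=> ab Pa loc.
pose S := [set x | a <= x <= b /\ P x].
have Sa : S a by split => //; rewrite lexx ab.
have ubS : ubound S b by move=> x [/andP[]].
have hS : has_sup S by split; [exists a | exists b].
have ac : a <= sup S by exact: (ub_le_sup (ex_intro _ b ubS)).
have cb : sup S <= b by apply: ge_sup => //; exists a.
have [|r r0 stepc] := loc (sup S); first by rewrite ac cb.
have [u [/andP[au ub] Pu] ru] := sup_adherent r0 hS.
have uc : u <= sup S by apply: (ub_le_sup (ex_intro _ b ubS)); split; rewrite ?au.
have [bc|bc] := ltP b (sup S + r).
  by apply: (stepc u b).
have Pv : P (sup S + r / 2) by apply: (stepc u) => //; lra.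
have : sup S + r / 2 <= sup S.
  by apply: (ub_le_sup (ex_intro _ b ubS)); split => //; lra.
lra.
Qed.

(** The list runs from right to left, so the tail lies in the part of [U] left of [p.1]. That part
    is disjoint from the head interval, and the induction adds the two measures. *)
Lemma sum_length_le_measure (R : realType) (s : seq (R * R)) (U : set R) :
  measurable U -> all (fun p => p.1 <= p.2) s ->
  pairwise (fun p q => q.2 <= p.1) s ->
  (forall p, p \in s -> `]p.1, p.2[ `<=` U) ->
  ((\sum_(p <- s) (p.2 - p.1))%:E <= @lebesgue_measure R U)%E.
Proof.
elim: s U => [|p s IH] U mU; first by rewrite big_nil.
move=> /= /andP[p12 als] /andP[/allP ps pws] sU.
rewrite big_cons addrC EFinD.
have mI : measurable (U `&` `]-oo, p.1[) by apply: measurableI.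
have mJ : measurable `]p.1, p.2[%classic by [].
apply: (@le_trans _ _ (@lebesgue_measure R ((U `&` `]-oo, p.1[) `|` `]p.1, p.2[))).
  rewrite measureU//; last first.
    rewrite -subset0 => x [] [_ /=]; rewrite !in_itv /= => xp /andP[px _].
    lra.
  apply: leeD.
    apply: IH => // q qs x xq; split; first by apply: (sU q) => //; rewrite inE qs orbT.
    move: xq; rewrite /= !in_itv /= => /andP[_ xq].
    exact: lt_le_trans xq (ps _ qs).
  have I12 : lebesgue_measure `]p.1, p.2[ = (p.2 - p.1)%:E.
    rewrite (@lebesgue_measure_itv R `]p.1, p.2[) /= lte_fin; case: ltP => // p21.
    by congr (_%:E); lra.
  by move: I12 => /esym/eqP; rewrite eq_le => /andP[].
apply: le_measure; rewrite ?inE//; first exact: measurableU.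
move=> x [[]//|]; apply: sU; exact: mem_head.
Qed.

(** Caratheodory's slope function is continuous at [x] with value [d], hence exceeds [- e] nearby.
    The increment over [u, v] is the sum of the slopes at [u] and [v] weighted by x - u and v -
    x. *)
Lemma is_derive_ge0_local (R : realType) (g : R -> R) (x d e : R) :
  is_derive x 1 g d -> 0 <= d -> 0 < e ->
  exists2 r, 0 < r & forall u v, u <= x -> x <= v -> x - r < u -> v < x + r ->
    - (e * (v - u)) <= g v - g u.
Proof.
move=> gx d0 e0.
have [h [gE ch hx]] := (is_derive1_caratheodory g x d).1 gx.
have /cvgrPdist_lt /(_ e e0) [r /= r0 hr] := ch.
exists r => // u v ux xv ru vr.
have hu : - e < h u.
  have /hr : ball x r u by rewrite /ball /= ger0_norm; lra.
  by rewrite hx ltr_distlC; lra.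
have hv : - e < h v.
  have /hr : ball x r v by rewrite /ball /= ler0_norm; lra.
  by rewrite hx ltr_distlC; lra.
have := gE u; have := gE v.
nra.
Qed.

(* The null set of bad points is covered by an open set U of small measure. Walking from
   a to b, steps around good points cost at most e times their length, while the other
   steps are disjoint intervals in U, to which absolute continuity applies. *)
Lemma abs_cont_le_of_ae_derive_ge0 (R : realType) (a b : R) (g : R -> R) :
  a <= b -> abs_cont_on a b g ->
  {ae (@lebesgue_measure R), forall x, x \in `]a, b[ ->
     exists2 d, 0 <= d & is_derive x 1 g d} ->
  g a <= g b.
Proof.
move=> ab acg aeg.
suff key e : 0 < e -> - e * (1 + (b - a)) <= g b - g a.
  rewrite -subr_ge0 leNgt; apply/negP => gba.
  have k0 : 0 < 2 * (1 + (b - a)) by lra.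
  (* With this [e] the bound reads (g b - g a) / 2 <= g b - g a, impossible for a negative
     increment. *)
  have := key (- (g b - g a) / (2 * (1 + (b - a)))).
  rewrite divr_gt0 ?oppr_gt0// => /(_ isT).
  suff -> : - (- (g b - g a) / (2 * (1 + (b - a)))) * (1 + (b - a)) = (g b - g a) / 2 by lra.
  by field; lra.
move=> e0; have [dl dl0 acd] := acg e e0.
(* The endpoints join the bad set because derivatives are known only inside the interval. *)
have [N [mN N0 subN]] : (@lebesgue_measure R).-negligible
    (~` [set x | x \in `]a, b[ -> exists2 d, 0 <= d & is_derive x 1 g d] `|` ([set a] `|` [set b])).
  apply: negligibleU; first exact: aeg.
  by apply: negligibleU; apply/negligibleP => //; exact: lebesgue_measure_set1.
have [|U [oU NU]] := lebesgue_regularity_outer mN _ dl0.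
  by apply: le_lt_trans (ltry 0); move/eqP: N0; rewrite eq_le => /andP[].
have mU := measurable_realfun.open_measurable oU.
have {}N0 : lebesgue_measure N = 0%E by exact: N0.
(* Outer regularity bounds the measure of [U] minus [N]; since [N] is null, the bound passes to
   [U]. *)
move=> UNd; have Ud : (@lebesgue_measure R U < dl%:E)%E.
  have := measureDI (@lebesgue_measure R) mU mN.
  rewrite (setIidr NU) => /eqP; rewrite eq_le => /andP[UN _].
  by apply: (le_lt_trans UN); move: UNd; rewrite -[X in (X < _)%E]adde0 -[in X in (X < _)%E]N0.
(* The list [s] records the steps made inside [U] so far, latest first; the term e * (x - a) pays
   for all the others. *)
pose P x := exists s : seq (R * R),
  [/\ all (fun p => (a <= p.1) && (p.1 <= p.2) && (p.2 <= x)) s,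
      pairwise (fun p q => q.2 <= p.1) s,
      forall p, p \in s -> `]p.1, p.2[ `<=` U &
      - (\sum_(p <- s) `|g p.2 - g p.1|) - e * (x - a) <= g x - g a].
have [||s [sab pws sU gba]] := real_induction ab (P := P).
- by exists [::]; split => //; rewrite big_nil; lra.
- move=> x xab.
  have [Ux|nUx] := pselect (U x).
    have [r /= r0 rU] := (@nbhs_ballP _ _ _ _).1 (open_nbhs_nbhs (conj oU Ux)).
    exists r => // u v au ux xv vb ru vr [s [sab pws sU gua]].
    exists ((u, v) :: s); split => /=.
    + rewrite au (le_trans ux xv) lexx /=; apply: sub_all sab => p /andP[-> pu] /=.
      by apply: le_trans pu _; lra.
    + rewrite pws andbT; apply: sub_all sab => p /andP[_]; exact.
    + move=> p; rewrite inE => /predU1P[->|]; last exact: sU.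
      move=> y; rewrite /= in_itv /= => /andP[uy yv]; apply: rU.
      by rewrite /ball /= ltr_norml; lra.
    + rewrite big_cons /=; have := ler_norm (- (g v - g u)); rewrite normrN.
      have : 0 <= e * (v - u) by rewrite mulr_ge0; lra.
      lra.
  have nNx : ~ N x by move=> /NU.
  have [xab'|/negP xab'] := boolP (x \in `]a, b[); last first.
    exfalso; apply: nNx; apply: subN; right.
    move: xab xab'; rewrite in_itv /= => /andP[ax xb].
    rewrite !lt_neqAle ax xb !andbT => /negP; rewrite negb_and !negbK.
    by move=> /orP[/eqP->|/eqP->]; [left|right].
  have [d d0 gx] : exists2 d, 0 <= d & is_derive x 1 g d.
    by apply: contrapT => nd; apply: nNx; apply: subN; left => /= /(_ xab').
  have [r r0 gr] := is_derive_ge0_local gx d0 e0.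
  exists r => // u v au ux xv vb ru vr [s [sab pws sU gua]].
  exists s; split => //.
    by apply: sub_all sab => p /andP[-> pu] /=; apply: le_trans pu _; lra.
  have := gr _ _ ux xv ru vr; lra.
have s_nth i : (i < size s)%N ->
    [/\ a <= (nth 0 s i).1, (nth 0 s i).1 <= (nth 0 s i).2 & (nth 0 s i).2 <= b].
  by move=> /(all_nthP 0 sab) /andP[/andP[]].
have slt : \sum_(p <- s) (p.2 - p.1) < dl.
  rewrite -lte_fin; apply: le_lt_trans Ud.
  apply: sum_length_le_measure => //.
  by apply: sub_all sab => p /andP[/andP[]].
have := acd (size s) (fun i => nth 0 s i).
rewrite -!(big_mkord xpredT (fun i => `|g (nth 0 s i).2 - g (nth 0 s i).1|)).
rewrite -!(big_mkord xpredT (fun i => (nth 0 s i).2 - (nth 0 s i).1)).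
rewrite -(big_nth 0 xpredT (fun p => p.2 - p.1)).
rewrite -(big_nth 0 xpredT (fun p => `|g p.2 - g p.1|)).
move=> /(_ _ _ slt) H.
suff : \sum_(p <- s) `|g p.2 - g p.1| < e by lra.
apply: H.
  by move=> i; have [] := s_nth i (ltn_ord i).
move=> i j ij; have /(pairwiseP 0) pw := pws.
have [lij|lji|/val_inj eij] := ltngtP i j.
- by right; exact: (pw i j (ltn_ord i) (ltn_ord j) lij).
- by left; exact: (pw j i (ltn_ord j) (ltn_ord i) lji).
- by rewrite eij eqxx in ij.
Qed.

(** * Closure properties of absolute continuity *)

Lemma abs_cont_onS (R : realType) (a b p q : R) (g : R -> R) :
  a <= p -> q <= b -> abs_cont_on a b g -> abs_cont_on p q g.
Proof.
move=> ap qb acg e e0; have [d d0 H] := acg e e0; exists d => // n s sab.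
by apply: H => i; have [? [? ?]] := sab i; split=> //; lra.
Qed.

(** Common source of absolute continuity for Lipschitz functions, sums and products: the sums of
    increments of [F] are at most a constant times those of [g] and [h]. *)
Lemma abs_cont_on_dominated (R : realType) (a b C : R) (g h F : R -> R) :
  (forall u v, a <= u -> u <= v -> v <= b ->
     `|F v - F u| <= C * (`|g v - g u| + `|h v - h u|)) ->
  abs_cont_on a b g -> abs_cont_on a b h -> abs_cont_on a b F.
Proof.
move=> Fgh acg ach e e0.
pose D := `|C| + 1; have D0 : 0 < D by rewrite /D; have := normr_ge0 C; lra.
have CD : C <= D by rewrite /D; have := ler_norm C; lra.
have eD0 : 0 < e / D / 2 by rewrite !divr_gt0.
have [d1 d10 H1] := acg _ eD0; have [d2 d20 H2] := ach _ eD0.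
exists (Num.min d1 d2); first by rewrite lt_min d10.
move=> n s sab dis; rewrite lt_min => /andP[s1 s2].
apply: (@le_lt_trans _ _ (D * (\sum_(i < n) `|g (s i).2 - g (s i).1| +
                               \sum_(i < n) `|h (s i).2 - h (s i).1|))).
  rewrite -big_split mulr_sumr /=; apply: ler_sum => i _.
  have [s1a [s12 s2b]] := sab i; apply: le_trans (Fgh _ _ s1a s12 s2b) _.
  by apply: ler_wpM2r => //; rewrite addr_ge0.
have := H1 _ _ sab dis s1; have := H2 _ _ sab dis s2.
rewrite -ltr_pdivlMl// mulrC; lra.
Qed.

Lemma lipschitz_abs_cont_on (R : realType) (a b C : R) (F : R -> R) :
  (forall u v, a <= u -> u <= v -> v <= b -> `|F v - F u| <= C * (v - u)) ->
  abs_cont_on a b F.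
Proof.
move=> lip; have acid : abs_cont_on a b id.
  move=> e e0; exists e => // n s sab _; apply: le_lt_trans.
  by apply: ler_sum => i _; have [_ [? _]] := sab i; rewrite ger0_norm// subr_ge0.
(* The identity serves as both dominating functions, hence the factor C / 2. *)
apply: (abs_cont_on_dominated _ acid acid (C := C / 2)) => u v au uv vb.
apply: le_trans (lip _ _ au uv vb) _.
by rewrite ger0_norm ?subr_ge0//; lra.
Qed.

(** Families of a single interval already give uniform continuity. *)
Lemma abs_cont_on_dist (R : realType) (a b : R) (g : R -> R) :
  abs_cont_on a b g -> forall e, 0 < e -> exists2 d, 0 < d &
    forall x y, x \in `[a, b] -> y \in `[a, b] -> `|x - y| < d -> `|g x - g y| < e.
Proof.
move=> acg e e0; have [d d0 H] := acg e e0; exists d => //.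
have ltxy u v : a <= u -> u <= v -> v <= b -> v - u < d -> `|g v - g u| < e.
  move=> au uv vb uvd; have := H 1%N (fun=> (u, v)); rewrite !big_ord1 /=; apply => //.
  by move=> i j; rewrite !ord1.
move=> x y; rewrite !in_itv /= => /andP[ax xb] /andP[ay yb].
have [xy|/ltW xy] := leP x y => d'.
  by rewrite distrC; apply: ltxy => //; rewrite distrC ger0_norm in d'; lra.
by apply: ltxy => //; rewrite ger0_norm in d'; lra.
Qed.

Lemma abs_cont_on_continuous (R : realType) (a b : R) (g : R -> R) :
  abs_cont_on a b g -> {within `[a, b], continuous g}.
Proof.
move=> /abs_cont_on_dist acg; apply/subspace_continuousP => x xab.
apply/cvgrPdist_lt => e e0; have [d d0 H] := acg e e0.
by rewrite near_withinE; apply/nbhs_ballP; exists d => //= y xy yab; exact: H.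
Qed.

Lemma within_continuous_bounded (R : realType) (a b : R) (g : R -> R) :
  {within `[a, b], continuous g} ->
  exists2 M, 0 <= M & forall x, a <= x -> x <= b -> `|g x| <= M.
Proof.
move=> cg; have /compact_bounded[M [_ gM]] := continuous_compact cg (@segment_compact _ a b).
exists (`|M| + 1); first by rewrite addr_ge0.
move=> x ax xb; apply: (gM (`|M| + 1)); first by have := ler_norm M; lra.
by exists x => //=; rewrite in_itv /= ax.
Qed.

Lemma abs_cont_onD (R : realType) (a b : R) (g h : R -> R) :
  abs_cont_on a b g -> abs_cont_on a b h -> abs_cont_on a b (fun x => g x + h x).
Proof.
apply: (abs_cont_on_dominated (C := 1)) => u v _ _ _.
by rewrite mul1r opprD addrACA ler_normD.
Qed.

Lemma abs_cont_onM (R : realType) (a b : R) (g h : R -> R) :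
  abs_cont_on a b g -> abs_cont_on a b h -> abs_cont_on a b (fun x => g x * h x).
Proof.
move=> acg ach.
have [M M0 gM] := within_continuous_bounded (abs_cont_on_continuous acg).
have [N N0 hN] := within_continuous_bounded (abs_cont_on_continuous ach).
apply: (abs_cont_on_dominated _ acg ach (C := M + N)) => u v au uv vb.
have -> : g v * h v - g u * h u = g v * (h v - h u) + (g v - g u) * h u by ring.
apply: le_trans (ler_normD _ _) _; rewrite !normrM.
have := gM v (le_trans au uv) vb; have := hN u au (le_trans uv vb).
have := normr_ge0 (g v - g u); have := normr_ge0 (h v - h u).
nra.
Qed.

(** By the mean value theorem [F] is Lipschitz; continuity on the closed interval covers the
    endpoints. *)
Lemma derive_bounded_abs_cont_on (R : realType) (a b C : R) (F dF : R -> R) :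
  {within `[a, b], continuous F} ->
  (forall x, a < x -> x < b -> is_derive x 1 F (dF x)) ->
  (forall x, a < x -> x < b -> `|dF x| <= C) ->
  abs_cont_on a b F.
Proof.
move=> cF FdF dFC; apply: (lipschitz_abs_cont_on (C := C)) => u v au.
rewrite le_eqVlt => /predU1P[->|uv] vb; first by rewrite !subrr normr0 mulr0.
have [||c] := @MVT R F dF u v uv.
- by move=> x; rewrite in_itv /= => /andP[ux xv]; apply: FdF; lra.
- by apply: continuous_subspaceW cF; apply: subset_itv; rewrite bnd_simp.
rewrite in_itv /= => /andP[uc cv] ->; rewrite normrM (@ger0_norm _ (v - u)); last lra.
by apply: ler_wpM2r; [lra|apply: dFC; lra].
Qed.

(** * Peano kernel estimate on one piece *)

(* k x = (x - r) (x - s) / 2 is the Peano kernel; Phi = k f1 - k' f + F has derivative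
   k f2 because k'' = 1. *)
Lemma peano_kernel_bound (R : realType) (p q r s : R) (f f1 f2 F K dK : R -> R) :
  p <= q -> abs_cont_on p q f -> abs_cont_on p q f1 -> abs_cont_on p q F ->
  abs_cont_on p q K ->
  (forall x, p < x -> x < q -> is_derive x 1 f (f1 x)) ->
  (forall x, p < x -> x < q -> is_derive x 1 F (f x)) ->
  (forall x, p < x -> x < q -> is_derive x 1 K (dK x)) ->
  {ae (@lebesgue_measure R), forall x, x \in `]p, q[ -> is_derive x 1 f1 (f2 x)} ->
  (forall x, p < x -> x < q -> `|(x - r) * (x - s) / 2 * f2 x| <= dK x) ->
  let Phi x := (x - r) * (x - s) / 2 * f1 x - (x - (r + s) / 2) * f x + F x in
  is_true (`|Phi q - Phi p| <= K q - K p).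
Proof.
move=> pq acf acf1 acF acK ff1 Ff KdK f1f2 kf2 Phi.
have acid : abs_cont_on p q id.
  by apply: (lipschitz_abs_cont_on (C := 1)) => u v *; rewrite ger0_norm; lra.
have accst c : abs_cont_on p q (fun=> c).
  by apply: (lipschitz_abs_cont_on (C := 0)) => u v *; rewrite subrr normr0; lra.
have acPhi : abs_cont_on p q Phi.
  apply: abs_cont_onD => //; apply: abs_cont_onD.
    apply: abs_cont_onM => //; do 2 (apply: abs_cont_onM => //).
      exact: abs_cont_onD.
    exact: abs_cont_onD.
  (* The minus sign becomes a constant factor, so that closure under sums and products suffices. *)
  have -> : (fun x => - ((x - (r + s) / 2) * f x)) =
            (fun x => (-1 * (x + - ((r + s) / 2))) * f x) by apply/funext => x; lra.
  by do 2 (apply: abs_cont_onM => //); exact: abs_cont_onD.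
have dPhi x : p < x -> x < q -> is_derive x 1 f1 (f2 x) ->
    is_derive x 1 Phi ((x - r) * (x - s) / 2 * f2 x).
  move=> px xq f12; have := ff1 x px xq; have := Ff x px xq => dF df.
  pose k := (fun x => (x - r) * (x - s) / 2) : R -> R.
  pose k1 := (fun x => x - (r + s) / 2) : R -> R.
  have dl c : is_derive x 1 (fun y : R => y - c) 1.
    have := is_deriveB (is_derive_id x 1) (is_derive_cst c x 1).
    by move=> /is_derive_eq; apply; rewrite subr0.
  have dk1 : is_derive x 1 k1 1 by exact: dl.
  have dk : is_derive x 1 k (x - (r + s) / 2).
    have := is_deriveM (is_deriveM (dl r) (dl s)) (is_derive_cst (2^-1 : R) x 1).
    move=> /is_derive_eq; apply.
    rewrite /GRing.scale /=; lra.
  apply: (is_derive_eq (is_deriveD (is_deriveB (is_deriveM dk f12) (is_deriveM dk1 df)) dF)).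
  rewrite /GRing.scale /= /k /k1; lra.
have key c : `|c| = 1 -> K p + c * Phi p <= K q + c * Phi q.
  move=> c1; apply: (abs_cont_le_of_ae_derive_ge0 (g := fun x => K x + c * Phi x)) => //.
    by apply: abs_cont_onD => //; exact: abs_cont_onM.
  apply: filterS f1f2; first exact: (ae_filter_ringOfSetsType (@lebesgue_measure R)).
  move=> x f12 xpq; have := f12 xpq.
  move: xpq; rewrite in_itv /= => /andP[px xq] {}f12.
  have := dPhi x px xq f12; have := kf2 x px xq; set D := _ * f2 x => DK dP.
  exists (dK x + c * D).
    have := ler_norm (- (c * D)); rewrite normrN normrM c1; lra.
  apply: (is_derive_eq (is_deriveD (KdK x px xq) (is_deriveM (is_derive_cst c x 1) dP))).
  by rewrite /GRing.scale /= mulr0 addr0.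
have := key 1 (normr1 _); have := key (- 1) (normrN1 _).
by rewrite ler_norml; lra.
Qed.

(* With t = (x - c) / D the kernel is D^2 t (3 t - 1) / 6; a negative D, with c the right
   endpoint, handles the right half. K is a primitive of the kernel's absolute value times
   B / t + A / (1 - t), from t (3 t - 1) / (1 - t) = 2 / (1 - t) - 3 t - 2. The factor t
   cancels the pole of the Godunova-Levin bound, so K is smooth up to t = 0. *)
Lemma simpson_piece (R : realType) (c D sg A B p q : R) (f f1 f2 F : R -> R) :
  D != 0 -> `|sg| = 1 -> 0 <= A -> 0 <= B -> p <= q ->
  abs_cont_on p q f -> abs_cont_on p q f1 -> abs_cont_on p q F ->
  (forall x, p < x -> x < q -> is_derive x 1 f (f1 x)) ->
  (forall x, p < x -> x < q -> is_derive x 1 F (f x)) ->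
  {ae (@lebesgue_measure R), forall x, x \in `]p, q[ -> is_derive x 1 f1 (f2 x)} ->
  let t x := (x - c) / D in
  (forall x, p <= x -> x <= q -> 0 <= t x <= 1 / 2) ->
  (forall x, p < x -> x < q -> 0 < t x /\ 0 <= sg * (3 * t x - 1)) ->
  (forall x, p < x -> x < q -> `|f2 x| <= B / t x + A / (1 - t x)) ->
  let Phi x := (x - c) * (x - (c + D / 3)) / 2 * f1 x
               - (x - (c + (c + D / 3)) / 2) * f x + F x in
  let K x := D ^+ 3 / 6 * sg * (B * (3 / 2 * t x ^+ 2 - t x)
               - A * (3 / 2 * t x ^+ 2 + 2 * t x + 2 * ln (1 - t x))) in
  is_true (`|Phi q - Phi p| <= K q - K p).
Proof.
move=> D0 sg1 A0 B0 pq acf acf1 acF ff1 Ff f1f2 t tpq tpos f2t Phi K.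
(* Here [sg] is the sign of 3 t - 1 on the piece. The factor t is already multiplied out, so the
   formula also makes sense at t = 0; [dKE] recovers the product form where t > 0. *)
pose dK x := D ^+ 2 / 6 * sg * (B * (3 * t x - 1) + A * (2 / (1 - t x) - 3 * t x - 2)).
have KdK x : p <= x -> x <= q -> is_derive x 1 K (dK x).
  move=> px xq; have t1 : 0 < 1 - t x by have := tpq x px xq; lra.
  have dt : is_derive x 1 t D^-1.
    have := is_deriveM (is_deriveB (is_derive_id x 1) (is_derive_cst c x 1))
      (is_derive_cst (D^-1 : R) x 1).
    by move=> /is_derive_eq; apply; rewrite /GRing.scale /=; lra.
  have dt1 : is_derive x 1 (fun y => 1 - t y) (- D^-1).
    have := is_deriveB (is_derive_cst (1 : R) x 1) dt.
    by move=> /is_derive_eq; apply; lra.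
  have dln : is_derive x 1 (fun y => ln (1 - t y)) (- D^-1 / (1 - t x)).
    have := is_derive1_comp (f := @ln R) (g := fun y => 1 - t y) (is_derive1_ln t1) dt1.
    by rewrite mulrC.
  have dt2 : is_derive x 1 (fun y => t y ^+ 2) (2 * t x * D^-1).
    have := is_deriveM dt dt.
    by move=> /is_derive_eq; apply; rewrite /GRing.scale /=; ring.
  have dcM (k : R) g dg : is_derive x 1 g dg -> is_derive x 1 (fun y : R => k * g y : R) (k * dg).
    move=> /(is_deriveM (is_derive_cst k x 1)).
    by move=> /is_derive_eq; apply; rewrite /GRing.scale /=; ring.
  have := dcM (D ^+ 3 / 6 * sg) _ _ (is_deriveB
    (dcM B _ _ (is_deriveB (dcM (3 / 2) _ _ dt2) dt))
    (dcM A _ _ (is_deriveD (is_deriveD (dcM (3 / 2) _ _ dt2) (dcM 2 _ _ dt)) (dcM 2 _ _ dln)))).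
  move=> /is_derive_eq; apply; rewrite /dK; field.
  by rewrite D0 lt0r_neq0.
have dKE x : p < x -> x < q ->
    dK x = D ^+ 2 / 6 * (t x * (sg * (3 * t x - 1))) * (B / t x + A / (1 - t x)).
  move=> px xq; have [t0 _] := tpos x px xq; have := tpq x (ltW px) (ltW xq) => t1.
  by rewrite /dK; field; rewrite !lt0r_neq0//; lra.
have acK : abs_cont_on p q K.
  (* For 0 <= t <= 1/2, |3 t - 1| <= 1 and, as 1 / (1 - t) <= 2, |2 / (1 - t) - 3 t - 2| <= 4. *)
  apply: (@derive_bounded_abs_cont_on R p q (D ^+ 2 / 6 * (B * 1 + A * 4)) K dK).
  + apply: derivable_within_continuous => x; rewrite in_itv /= => /andP[px xq].
    by have [] := KdK x px xq.
  + by move=> x /ltW px /ltW xq; exact: KdK.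
  + move=> x /ltW px /ltW xq; have t01 := tpq x px xq.
    have C0 : 0 <= D ^+ 2 / 6 by rewrite mulr_ge0// sqr_ge0.
    rewrite /dK -(mulrA (D ^+ 2 / 6) sg) normrM (ger0_norm C0) normrM sg1 mul1r.
    apply: ler_wpM2l => //.
    apply: le_trans (ler_normD _ _) _; rewrite !normrM (ger0_norm A0) (ger0_norm B0).
    apply: lerD; apply: ler_wpM2l => //; first by rewrite ler_norml; lra.
    have t1 : 0 < 1 - t x by lra.
    have i2 : (1 - t x)^-1 <= 2 by rewrite -[leRHS]invrK lef_pV2 ?posrE//; lra.
    have i0 : 0 < (1 - t x)^-1 by rewrite invr_gt0.
    by rewrite ler_norml; lra.
have kf2 x : p < x -> x < q -> `|(x - c) * (x - (c + D / 3)) / 2 * f2 x| <= dK x.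
  move=> px xq; have [t0 s0] := tpos x px xq; rewrite dKE//.
  have C0 : 0 <= D ^+ 2 / 6 by rewrite mulr_ge0// sqr_ge0.
  have -> : (x - c) * (x - (c + D / 3)) / 2 = D ^+ 2 / 6 * (t x * (3 * t x - 1)).
    by rewrite /t; field.
  have sE : `|3 * t x - 1| = sg * (3 * t x - 1).
    by rewrite -[RHS](ger0_norm s0) normrM sg1 mul1r.
  rewrite normrM normrM (ger0_norm C0) normrM (gtr0_norm t0) sE.
  apply: ler_wpM2l; last exact: f2t.
  by apply: mulr_ge0 => //; apply: mulr_ge0 => //; exact: ltW.
exact: (peano_kernel_bound pq acf acf1 acF acK ff1 Ff
  (fun x px xq => KdK x (ltW px) (ltW xq)) f1f2 kf2).
Qed.

(** * The primitive of f and the interior of I *)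

Lemma is_derive_Rintegral (R : realType) (a b x : R) (f : R -> R) :
  {within `[a, b], continuous f} -> a < x -> x < b ->
  is_derive x 1 (fun y => Rintegral (@lebesgue_measure R) `[a, y] f) (f x).
Proof.
move=> cf ax xb.
have fi : (@lebesgue_measure R).-integrable `[a, b] (EFin \o f).
  by apply: continuous_compact_integrable => //; exact: segment_compact.
have [cfi _ _] := (continuous_within_itvP _ (lt_trans ax xb)).1 cf.
have cfx : {for x, continuous f} by apply: cfi; rewrite in_itv /= ax.
have [dF F'] := continuous_FTC1_closed xb fi ax cfx.
by apply: DeriveDef; [exact: dF|rewrite -derive1E; exact: F'].
Qed.

Lemma continuous_Rintegral (R : realType) (a b : R) (f : R -> R) :
  a <= b -> {within `[a, b], continuous f} ->
  {within `[a, b], continuous (fun y => Rintegral (@lebesgue_measure R) `[a, y] f)}.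
Proof.
move=> ab cf; apply: (parameterized_integral_continuous ab).
by apply: continuous_compact_integrable => //; exact: segment_compact.
Qed.

Lemma itv_oo_sub_interior (R : realType) (I : set R) (a b x : R) :
  is_interval I -> I a -> I b -> a < x -> x < b -> (interior I) x.
Proof.
move=> iI Ia Ib ax xb.
apply: (@filterS _ (nbhs x) _ `]a, b[%classic).
  by move=> y; rewrite /= in_itv /= => /andP[ay yb]; apply: (iI a b) => //; rewrite !ltW.
by apply: open_nbhs_nbhs; split; [exact: interval_open|rewrite /= in_itv /= ax].
Qed.

(** * Simpson error assembled from four pieces *)

Theorem theorem1 (R : realType) (I : set R) (a b : R) (f f1 f2 : R -> R) :
  is_interval I -> I a -> I b -> a < b ->
  (* f is differentiable on the interior of I, with derivative f1 *)
  (forall x, (interior I) x -> is_derive x 1 f (f1 x)) ->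
  (* f and f' are absolutely continuous on [a,b] *)
  abs_cont_on a b f -> abs_cont_on a b f1 ->
  (* f'' = f2 almost everywhere on [a,b], and f'' is in L[a,b] *)
  {ae (@lebesgue_measure R), forall x, x \in `]a, b[ -> is_derive x 1 f1 (f2 x)} ->
  (@lebesgue_measure R).-integrable `[a, b] (EFin \o f2) ->
  (* |f''| belongs to Q(I) *)
  GL_class I (fun x => `|f2 x|) ->
  `| (b - a)^-1 * Rintegral (@lebesgue_measure R) `[a, b] f
     - 6^-1 * (f a + 4 * f ((a + b) / 2) + f b) |
  <= (b - a) ^+ 2 / 6 * ((12 * ln 2 - 8 * ln 3 + 1) / 2) * (`|f2 a| + `|f2 b|).
Proof.
move=> iI Ia Ib ab ff1 acf acf1 f1f2 _ [_ f2Q].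
pose L := b - a; have L0 : 0 < L by rewrite subr_gt0.
pose F x := Rintegral (@lebesgue_measure R) `[a, x] f.
have cf := abs_cont_on_continuous acf.
have [M M0 fM] := within_continuous_bounded cf.
have dF x : a < x -> x < b -> is_derive x 1 F (f x) by exact: is_derive_Rintegral.
have acF : abs_cont_on a b F.
  apply: (derive_bounded_abs_cont_on (C := M) (dF := f)) => //.
    by apply: continuous_Rintegral => //; exact: ltW.
  by move=> x /ltW ax /ltW xb; exact: fM.
have Fa : F a = 0 by rewrite /F set_itv1 Rintegral_set1.
have f1f2S p q : a <= p -> q <= b ->
    {ae (@lebesgue_measure R), forall x, x \in `]p, q[ -> is_derive x 1 f1 (f2 x)}.
  move=> ap qb; apply: filterS f1f2.
    exact: (ae_filter_ringOfSetsType (@lebesgue_measure R)).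
  move=> x H xpq; apply: H; move: xpq; rewrite !in_itv /= => /andP[px xq].
  by rewrite (le_lt_trans ap px) (lt_le_trans xq qb).
have piece c D sg A B p q (D0 : D != 0) sg1 A0 B0 (ap : a <= p) pq (qb : q <= b) :=
  @simpson_piece R c D sg A B p q f f1 f2 F D0 sg1 A0 B0 pq
    (abs_cont_onS ap qb acf) (abs_cont_onS ap qb acf1) (abs_cont_onS ap qb acF)
    (fun x px xq => ff1 x (itv_oo_sub_interior iI Ia Ib (le_lt_trans ap px) (lt_le_trans xq qb)))
    (fun x px xq => dF x (le_lt_trans ap px) (lt_le_trans xq qb)) (f1f2S p q ap qb).
have itvP u v w : v * L <= u <= w * L -> v <= u / L <= w.
  by rewrite ler_pdivlMr// ler_pdivrMr.
have itvPl u v : v * L < u -> v < u / L by rewrite ltr_pdivlMr.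
(* The class Q is applied to x = t b + (1 - t) a with t = (x - a) / L; [right] measures t from [b]
   instead. *)
have left x : a < x -> x < b ->
    `|f2 x| <= `|f2 b| / ((x - a) / L) + `|f2 a| / (1 - (x - a) / L).
  move=> ax xb; have := @f2Q b a ((x - a) / L) Ib Ia.
  have -> : (x - a) / L * b + (1 - (x - a) / L) * a = x by rewrite /L; field; lra.
  by apply; rewrite divr_gt0 ?subr_gt0//= ltr_pdivrMr// mul1r /L; lra.
have tb x : (x - b) / - L = (b - x) / L by rewrite invrN mulrN -mulNr opprB.
have right x : a < x -> x < b ->
    `|f2 x| <= `|f2 a| / ((x - b) / - L) + `|f2 b| / (1 - (x - b) / - L).
  move=> ax xb; rewrite tb; have := @f2Q a b ((b - x) / L) Ia Ib.
  have -> : (b - x) / L * a + (1 - (b - x) / L) * b = x by rewrite /L; field; lra.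
  by apply; rewrite divr_gt0 ?subr_gt0//= ltr_pdivrMr// mul1r /L; lra.
(* The kernel changes sign at [p1] and [p2], where t = 1/3; at [m], where t = 1/2, the left kernel
   gives way to the right one. The signs on the four pieces are -, +, +, -. *)
pose m := (a + b) / 2; pose p1 := a + L / 3; pose p2 := b - L / 3.
have Ln0 : L != 0 by rewrite gt_eqF.
have NLn0 : - L != 0 by rewrite oppr_eq0.
have A0 := normr_ge0 (f2 a); have B0 := normr_ge0 (f2 b).
have ln12 : ln (1 - 1 / 2 : R) = - ln 2.
  have -> : 1 - 1 / 2 = 2^-1 :> R by lra.
  by rewrite lnV// posrE.
have ln23 : ln (1 - 1 / 3 : R) = ln 2 - ln 3.
  have -> : 1 - 1 / 3 = 2 / 3 :> R by lra.
  by rewrite ln_div// posrE.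
have ta : (a - a) / L = 0 by rewrite subrr mul0r.
have tp1 : (p1 - a) / L = 1 / 3 by rewrite /p1; field.
have tm : (m - a) / L = 1 / 2 by rewrite /m /L; field; lra.
have tm' : (b - m) / L = 1 / 2 by rewrite /m /L; field; lra.
have tp2 : (b - p2) / L = 1 / 3 by rewrite /p2; field.
have tb' : (b - b) / L = 0 by rewrite subrr mul0r.
have [lp1 lm lp2] : [/\ a <= p1 <= b, a <= m <= b & a <= p2 <= b].
  by split; rewrite /p1 /m /p2 /L; lra.
(* The local definitions are restated as equations for [lra]. *)
have hL : L = b - a by [].
have hm : m = (a + b) / 2 by [].
have hp1 : p1 = a + L / 3 by [].
have hp2 : p2 = b - L / 3 by [].
(* The primitive of [simpson_piece] is D^3 / 6 * sg * G; its values are needed only at t = 0, 1/3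
   and 1/2. *)
pose G A B t : R := B * (3 / 2 * t ^+ 2 - t) - A * (3 / 2 * t ^+ 2 + 2 * t + 2 * ln (1 - t)).
pose Phi c D x := (x - c) * (x - (c + D / 3)) / 2 * f1 x - (x - (c + (c + D / 3)) / 2) * f x + F x.
have G0 A B : G A B 0 = 0 by rewrite /G (subr0 1) ln1; ring.
have G3 A B : G A B (1 / 3) = B * (- (1 / 6)) - A * (5 / 6 + 2 * (ln 2 - ln 3)).
  by rewrite /G ln23; field.
have G2 A B : G A B (1 / 2) = B * (- (1 / 8)) - A * (11 / 8 - 2 * ln 2).
  by rewrite /G ln12; field.
have H1 : `|Phi a L p1 - Phi a L a| <= L ^+ 3 / 6 * -1 * G `|f2 a| `|f2 b| ((p1 - a) / L)
                                   - L ^+ 3 / 6 * -1 * G `|f2 a| `|f2 b| ((a - a) / L).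
  apply: (piece a L (- 1) `|f2 a| `|f2 b| a p1 Ln0 (normrN1 _) A0 B0); [lra|lra|lra| | |].
  - by move=> x ? ?; apply: itvP; lra.
  - move=> x ? ?; split; first by apply: itvPl; lra.
    by have := itvP (x - a) 0 (1 / 3); lra.
  - by move=> x ? ?; apply: left; lra.
have H2 : `|Phi a L m - Phi a L p1| <= L ^+ 3 / 6 * 1 * G `|f2 a| `|f2 b| ((m - a) / L)
                                   - L ^+ 3 / 6 * 1 * G `|f2 a| `|f2 b| ((p1 - a) / L).
  apply: (piece a L 1 `|f2 a| `|f2 b| p1 m Ln0 (normr1 _) A0 B0); [lra|lra|lra| | |].
  - by move=> x ? ?; apply: itvP; lra.
  - move=> x ? ?; split; first by apply: itvPl; lra.
    by have := itvP (x - a) (1 / 3) (1 / 2); lra.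
  - by move=> x ? ?; apply: left; lra.
(* On the right half t decreases in x, D = - L, and the values at [a] and [b] exchange roles. *)
have H3 : `|Phi b (- L) p2 - Phi b (- L) m| <=
    (- L) ^+ 3 / 6 * 1 * G `|f2 b| `|f2 a| ((p2 - b) / - L)
    - (- L) ^+ 3 / 6 * 1 * G `|f2 b| `|f2 a| ((m - b) / - L).
  apply: (piece b (- L) 1 `|f2 b| `|f2 a| m p2 NLn0 (normr1 _) B0 A0); [lra|lra|lra| | |].
  - by move=> x ? ?; rewrite tb; apply: itvP; lra.
  - move=> x ? ?; rewrite tb; split; first by apply: itvPl; lra.
    by have := itvP (b - x) (1 / 3) (1 / 2); lra.
  - by move=> x ? ?; apply: right; lra.
have H4 : `|Phi b (- L) b - Phi b (- L) p2| <=
    (- L) ^+ 3 / 6 * -1 * G `|f2 b| `|f2 a| ((b - b) / - L)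
    - (- L) ^+ 3 / 6 * -1 * G `|f2 b| `|f2 a| ((p2 - b) / - L).
  apply: (piece b (- L) (- 1) `|f2 b| `|f2 a| p2 b NLn0 (normrN1 _) B0 A0); [lra|lra|lra| | |].
  - by move=> x ? ?; rewrite tb; apply: itvP; lra.
  - move=> x ? ?; rewrite tb; split; first by apply: itvPl; lra.
    by have := itvP (b - x) 0 (1 / 3); lra.
  - by move=> x ? ?; apply: right; lra.
rewrite !tb in H3 H4.
rewrite ta tp1 in H1; rewrite tm tp1 in H2; rewrite tm' tp2 in H3; rewrite tb' tp2 in H4.
rewrite !G0 !G3 !G2 in H1 H2 H3 H4.
(* The two kernels agree at [m], so [f1 m] cancels, while their derivatives there are L / 3 and - L
   / 3, whose jump gives the weight 4 of [f m]. The kernels vanish at [a] and [b], so no other value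
   of [f1] survives. *)
have PhiE : (Phi b (- L) b - Phi b (- L) p2) + (Phi b (- L) p2 - Phi b (- L) m)
    + (Phi a L m - Phi a L p1) + (Phi a L p1 - Phi a L a)
    = F b - L / 6 * (f a + 4 * f m + f b).
  by rewrite /Phi Fa hm hL; field.
have S : `|F b - L / 6 * (f a + 4 * f m + f b)| <=
    L ^+ 3 / 6 * ((12 * ln 2 - 8 * ln 3 + 1) / 2) * (`|f2 a| + `|f2 b|).
  rewrite -PhiE.
  do 3 (apply: le_trans (ler_normD _ _) _; rewrite -lerBrDr).
  apply: le_trans H4 _; rewrite !lerBrDr.
  apply: le_trans (lerD (lerD (lerD (lexx _) H3) H2) H1) _.
  (* Up to L^3 / 6 each half contributes G(1/2) - 2 G(1/3): the coefficient is 7/24 + 6 ln 2 - 4 ln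
     3 for its own endpoint and 5/24 for the opposite one. Over both halves each endpoint gets 1/2 +
     6 ln 2 - 4 ln 3. *)
  by rewrite le_eqVlt; apply/orP; left; apply/eqP; field.
have -> : (b - a)^-1 * Rintegral (@lebesgue_measure R) `[a, b] f
     - 6^-1 * (f a + 4 * f m + f b) = L^-1 * (F b - L / 6 * (f a + 4 * f m + f b)).
  by rewrite /F hL; field; lra.
rewrite normrM gtr0_norm ?invr_gt0// ler_pdivrMl//.
by apply: le_trans S _; rewrite -/L le_eqVlt; apply/orP; left; apply/eqP; ring.
Qed.
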